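(* Let $n \geq 2$ be an integer. Consider independent, identically distributed random variables $X_1, \dots, X_n$ taking values in the non-negative integers with $\mathbb{E}[X_i] = 1$. Over all such common distributions, the minimum of $P\left(\sum_{i=1}^n X_i \leq n\right)$ equals $\left(1 - \frac{1}{n+1}\right)^n$, and it is attained by the distribution with $P(X_i = 0) = 1 - \frac{1}{n+1}$ and $P(X_i = n+1) = \frac{1}{n+1}$. *)

(* Defs.v *)
From HB Require Import structures.
From mathcomp Require Import all_boot all_order all_algebra.
From mathcomp Require Import all_classical all_reals.
From mathcomp Require Import topology normedtype sequences.

Set Implicit Arguments.
Unset Strict Implicit.
Unset Printing Implicit Defensive.

Import Order.TTheory GRing.Theory Num.Theory.
Import numFieldNormedType.Exports.
Local Open Scope classical_set_scope.
Local Open Scope ring_scope.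

Definition is_nat_distr (R : realType) (p : nat -> R) : Prop :=
  (forall k, 0 <= p k) /\ series p @ \oo --> (1 : R).

Definition has_mean (R : realType) (p : nat -> R) (m : R) : Prop :=
  series (fun k => k%:R * p k) @ \oo --> m.

(* For X_1, ..., X_n i.i.d. with law p, the joint law is the product
   \prod_i p (x_i).  Since the X_i are non-negative integers,
   X_1 + ... + X_n <= n forces every x_i <= n, hence
   P(X_1 + ... + X_n <= n) is the finite sum below over x : 'I_n -> 'I_(n+1). *)
Definition prob_sum_le_n (R : realType) (n : nat) (p : nat -> R) : R :=
  \sum_(x : {ffun 'I_n -> 'I_n.+1} | (\sum_(i < n) (x i : nat) <= n)%N)
     \prod_(i < n) p (x i : nat).

Definition extremal_distr (R : realType) (n : nat) (k : nat) : R :=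
  if k == 0%N then 1 - (n.+1%:R)^-1
  else if k == n.+1 then (n.+1%:R)^-1 else 0.

(* Main.v *)
(** A law on the non-negative integers with mean 1 is a mixture of two-point
laws of mean 1 on {0, k}, so by multilinearity it suffices to treat independent
X_i with P(X_i = k_i) = 1/k_i = 1 - P(X_i = 0). Put l_i = k_i - 1,
W = n - (X_1 + ... + X_n) = \sum_i (1 - X_i) and psi = P(W >= 0).

Expanding one factor of (W^+)^2 = W W^+ gives
E (W^+)^2 = \sum_i E[(1 - X_i) W^+], and resampling X_i bounds the i-th term by
both l_i psi and E W^+. If e > 0 solves \sum_i min(l_i, e) = e^2, then
W^+ <= ((W^+)^2 / e + e 1_{W >= 0}) / 2 turns these bounds into
E (W^+)^2 <= e^2 psi.

In the other direction, with a_i = min(l_i, e) / e (so \sum_i a_i = e), one has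
E ((y + 1 - X_i)^+)^2 >= e / (e + a_i) * ((y + a_i)^+)^2 for every real y.
Iterating over i gives E (W^+)^2 >= e^2 / \prod_i (1 + a_i / e), which is at
least e^2 (1 + 1/n)^-n by AM-GM. *)
Require Import Defs.
From HB Require Import structures.
From mathcomp Require Import all_boot all_order all_algebra.
From mathcomp Require Import all_classical all_reals.
From mathcomp Require Import topology normedtype sequences.
From mathcomp Require Import realfun ring lra zify.
Set Implicit Arguments.
Unset Strict Implicit.
Unset Printing Implicit Defensive.
Import Order.TTheory GRing.Theory Num.Theory.
Import numFieldNormedType.Exports.
Local Open Scope ring_scope.

(** * Independent fair bets: expectation and resampling *)

(* A fair bet wins 1 with probability l / (l + 1) and loses l otherwise; [true]
   marks a loss, so that X_i = b_i (l_i + 1) and W is the total gain. *)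
Definition bet_weight (R : realFieldType) (l : nat) (b : bool) : R :=
  if b then l.+1%:R^-1 else l%:R / l.+1%:R.

Definition bets_weight (R : realFieldType) (n : nat) (l : 'I_n -> nat)
    (b : {ffun 'I_n -> bool}) : R :=
  \prod_(i < n) bet_weight R (l i) (b i).

Definition expect (R : realFieldType) (n : nat) (l : 'I_n -> nat)
    (F : {ffun 'I_n -> bool} -> R) : R :=
  \sum_b bets_weight R l b * F b.

Definition update (n : nat) (b : {ffun 'I_n -> bool}) (i : 'I_n) (v : bool) :
    {ffun 'I_n -> bool} :=
  [ffun j => if j == i then v else b j].

Definition total_loss (n : nat) (l : 'I_n -> nat) (b : {ffun 'I_n -> bool}) :
    nat :=
  (\sum_(i < n) b i * (l i).+1)%N.

Definition sq_pos (R : realFieldType) (w : R) : R := Num.max w 0 ^+ 2.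

Lemma bet_weight_ge0 (R : realFieldType) (l : nat) (b : bool) :
  0 <= bet_weight R l b.
Proof. by case: b; rewrite /bet_weight ?invr_ge0 ?divr_ge0 ?ler0n. Qed.

Lemma bet_weight_sum (R : realFieldType) (l : nat) :
  bet_weight R l false + bet_weight R l true = 1.
Proof.
rewrite /bet_weight -[X in _ + X]mul1r -mulrDl natr1 divff //.
by rewrite pnatr_eq0.
Qed.

Lemma bets_weight_ge0 (R : realFieldType) (n : nat) (l : 'I_n -> nat) b :
  0 <= bets_weight R l b.
Proof. by apply: prodr_ge0 => i _; apply: bet_weight_ge0. Qed.

Lemma updateii (n : nat) (b : {ffun 'I_n -> bool}) i v : update b i v i = v.
Proof. by rewrite ffunE eqxx. Qed.

Lemma updateij (n : nat) (b : {ffun 'I_n -> bool}) i v j :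
  j != i -> update b i v j = b j.
Proof. by rewrite ffunE => /negPf ->. Qed.

Lemma update_id (n : nat) (b : {ffun 'I_n -> bool}) i : update b i (b i) = b.
Proof. by apply/ffunP => j; rewrite ffunE; case: eqP => [->|]. Qed.

Lemma expectD (R : realFieldType) (n : nat) (l : 'I_n -> nat) F G :
  expect l (fun b => F b + G b) = expect l F + expect l G :> R.
Proof. by rewrite /expect -big_split; apply: eq_bigr => b _; rewrite mulrDr. Qed.

Lemma expectZ (R : realFieldType) (n : nat) (l : 'I_n -> nat) (a : R) F :
  expect l (fun b => a * F b) = a * expect l F.
Proof. by rewrite /expect mulr_sumr; apply: eq_bigr => b _; rewrite mulrCA. Qed.

Lemma expect_sum (R : realFieldType) (n : nat) (l : 'I_n -> nat)
    (F : 'I_n -> {ffun 'I_n -> bool} -> R) :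
  expect l (fun b => \sum_i F i b) = \sum_i expect l (F i).
Proof.
by rewrite /expect exchange_big; apply: eq_bigr => b _; rewrite mulr_sumr.
Qed.

Lemma le_expect (R : realFieldType) (n : nat) (l : 'I_n -> nat) F G :
  (forall b, F b <= G b) -> expect l F <= expect l G :> R.
Proof.
by move=> FG; apply: ler_sum => b _; rewrite ler_wpM2l ?bets_weight_ge0.
Qed.

Lemma bets_weight1 (R : realFieldType) (n : nat) (l : 'I_n -> nat) :
  \sum_b bets_weight R l b = 1.
Proof.
rewrite /bets_weight -(bigA_distr_bigA (fun i b => bet_weight R (l i) b)).
by apply: big1 => i _; rewrite big_bool /= addrC bet_weight_sum.
Qed.

Lemma expect_cst (R : realFieldType) (n : nat) (l : 'I_n -> nat) (a : R) :
  expect l (fun=> a) = a.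
Proof. by rewrite /expect -mulr_suml bets_weight1 mul1r. Qed.

(** Flipping coordinate i is an involution of the sample space that only exchanges the i-th factor
    of the weight. Splitting the weight by the two values of that coordinate and reindexing one half
    along the flip gives the average. *)
Lemma expect_resample (R : realFieldType) (n : nat) (l : 'I_n -> nat)
    (i : 'I_n) (F : {ffun 'I_n -> bool} -> R) :
  expect l F = expect l (fun b =>
    bet_weight R (l i) false * F (update b i false) +
    bet_weight R (l i) true * F (update b i true)).
Proof.
pose flip b := update b i (~~ b i).
have flipK : involutive flip.
  by move=> b; apply/ffunP => j; rewrite !ffunE eqxx; case: eqP => [->|]; rewrite ?negbK.
transitivity (expect l (fun b =>
    bet_weight R (l i) (b i) * F b + bet_weight R (l i) (~~ b i) * F (flip b))).
  rewrite expectD {3}/expect (reindex_inj (inv_inj flipK)) -big_split /=.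
  apply: eq_bigr => b _; rewrite flipK updateii negbK.
  have -> : bets_weight R l (flip b) * (bet_weight R (l i) (b i) * F b) =
            bets_weight R l b * (bet_weight R (l i) (~~ b i) * F b).
    rewrite /bets_weight (bigD1 i) //= [in RHS](bigD1 i) //= updateii.
    rewrite (eq_bigr (fun j => bet_weight R (l j) (b j))); first by ring.
    by move=> j ji; rewrite updateij.
  rewrite -!mulrDr -mulrDl.
  suff -> : bet_weight R (l i) (b i) + bet_weight R (l i) (~~ b i) = 1.
    by rewrite mul1r.
  by case: (b i); rewrite /= ?bet_weight_sum // addrC bet_weight_sum.
apply: eq_bigr => b _; congr (_ * _); rewrite /flip.
have := update_id b i; case: (b i) => /= ->; first by rewrite addrC.
by [].
Qed.

Lemma le_expect_resample (R : realFieldType) (n : nat) (l : 'I_n -> nat)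
    (i : 'I_n) (F G : {ffun 'I_n -> bool} -> R) :
  (forall b, bet_weight R (l i) false * F (update b i false) +
             bet_weight R (l i) true * F (update b i true) <=
             bet_weight R (l i) false * G (update b i false) +
             bet_weight R (l i) true * G (update b i true)) ->
  expect l F <= expect l G.
Proof.
move=> FG; rewrite (expect_resample _ i F) (expect_resample _ i G).
exact: le_expect.
Qed.

(** * Upper bound on the second moment of W^+ *)

Lemma total_loss_update (n : nat) (l : 'I_n -> nat) b i v :
  total_loss l (update b i v) =
  (v * (l i).+1 + \sum_(j < n | j != i) b j * (l j).+1)%N.
Proof.
rewrite /total_loss (bigD1 i) //= updateii; congr (_ + _)%N.
by apply: eq_bigr => j ji; rewrite updateij.
Qed.

(* Integrality enters here: a gap n - s < l + 1 is at most l. *)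
Lemma bet_gain_le_prob (R : realFieldType) (n : nat) (l : 'I_n -> nat) i :
  expect l (fun b => (1 - (b i * (l i).+1)%:R) * (n - total_loss l b)%:R) <=
  (l i)%:R * expect l (fun b => (total_loss l b <= n)%N%:R) :> R.
Proof.
rewrite -expectZ; apply: (le_expect_resample (i := i)) => b.
rewrite !total_loss_update !updateii mul1n !mul0n add0n !subr0 /bet_weight.
move: (\sum_(j < n | _) _)%N (l i) => s k.
have k0 : (0 : R) < k.+1%:R by rewrite ltr0n.
have -> : (k%:R / k.+1%:R * (1 * (n - s)%:R) +
    k.+1%:R^-1 * ((1 - k.+1%:R) * (n - (k.+1 + s))%:R) : R) =
  k%:R / k.+1%:R * (n - s - (n - (k.+1 + s)))%N%:R.
  rewrite [in RHS]natrB; last by lia.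
  by rewrite -[k.+1%:R]natr1; field; rewrite natr1 gt_eqF.
have -> : (k%:R / k.+1%:R * (k%:R * (s <= n)%N%:R) +
    k.+1%:R^-1 * (k%:R * (k.+1 + s <= n)%N%:R) : R) =
  k%:R / k.+1%:R * (k * (s <= n) + (k.+1 + s <= n))%N%:R.
  by rewrite natrD natrM; field; rewrite addrC natr1 gt_eqF.
(* What remains is an inequality in [nat]: if k + 1 + s <= n both sides are k + 1, if s <= n < k + 1
   + s it reads n - s <= k, and otherwise both vanish. *)
rewrite ler_wpM2l ?divr_ge0 ?ler0n // ler_nat.
by case: (leqP s n) => h1; case: (leqP (k.+1 + s) n) => h2; lia.
Qed.

Lemma bet_gain_le_mean (R : realFieldType) (n : nat) (l : 'I_n -> nat) i :
  expect l (fun b => (1 - (b i * (l i).+1)%:R) * (n - total_loss l b)%:R) <=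
  expect l (fun b => (n - total_loss l b)%:R) :> R.
Proof.
apply: le_expect => b; rewrite ler_piMl ?ler0n //.
by rewrite lerBlDr lerDl ler0n.
Qed.

(** Subtraction in [nat] truncates, so [(n - total_loss l b)%:R] is W^+. The identity expands the
    factor W of W W^+ = (W^+)^2. *)
Lemma second_moment_gains (R : realFieldType) (n : nat) (l : 'I_n -> nat) :
  expect l (fun b => (n - total_loss l b)%:R ^+ 2) =
  \sum_(i < n) expect l (fun b =>
    (1 - (b i * (l i).+1)%:R) * (n - total_loss l b)%:R) :> R.
Proof.
rewrite -expect_sum; apply: eq_bigr => b _; congr (_ * _).
rewrite -mulr_suml sumrB sumr_const card_ord -natr_sum -/(total_loss l b).
case: (leqP (total_loss l b) n) => h; first by rewrite expr2 natrB.
by rewrite (eqP (ltnW h)) expr2 !mulr0.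
Qed.

Lemma second_moment_le (R : realFieldType) (n : nat) (l : 'I_n -> nat) (e : R) :
  0 < e -> \sum_(i < n) Num.min (l i)%:R e = e ^+ 2 ->
  expect l (fun b => (n - total_loss l b)%:R ^+ 2) <=
  e ^+ 2 * expect l (fun b => (total_loss l b <= n)%N%:R).
Proof.
move=> e0 He; set M := expect l _; set P := expect l _.
have mean_le : expect l (fun b => (n - total_loss l b)%:R) <= (M / e + e * P) / 2.
  rewrite mulrDl ![_ * 2^-1]mulrC -(mulrC e^-1) mulrA -!expectZ -expectD.
  apply: le_expect => b; case: (leqP (total_loss l b) n) => h; last first.
    by rewrite (eqP (ltnW h)) expr2 !mulr0 addr0.
  set v := (n - _)%:R; rewrite mulr1 -subr_ge0.
  have -> : 2^-1 / e * v ^+ 2 + 2^-1 * e - v = (v - e) ^+ 2 / (2 * e).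
    by field; rewrite gt_eqF.
  by rewrite divr_ge0 ?sqr_ge0 // mulr_ge0 // ltW.
have P0 : 0 <= P by rewrite -(expect_cst l 0); apply: le_expect => b; rewrite ler0n.
(* [a] counts the bets with l_i >= e, whose gain is bounded through the mean; the others use the
   bound by [P]. Each counted bet contributes e to the balance equation, hence a <= e. *)
pose a : R := \sum_(i < n) (e <= (l i)%:R)%R%:R.
have ae : a <= e.
  rewrite -(ler_pM2r e0) -expr2 -He mulr_suml; apply: ler_sum => i _.
  by case: (leP e) => h; rewrite /= ?mulr1n ?mul1r // mulr0n mul0r ler0n.
have : M <= a / (2 * e) * (M - e ^+ 2 * P) + e ^+ 2 * P.
  rewrite {1}/M second_moment_gains -{2}He !mulr_suml -big_split /=.
  apply: ler_sum => i _; case: (leP e) => h; last first.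
    by rewrite /= mulr0n !mul0r add0r; apply: bet_gain_le_prob.
  apply: le_trans (bet_gain_le_mean _ _ _) _; apply: le_trans mean_le _.
  rewrite /= mulr1n le_eqVlt; apply/orP; left; apply/eqP.
  by field; rewrite gt_eqF.
rewrite -subr_ge0 => H; rewrite -subr_ge0.
(* As a / (2e) <= 1/2, the multiple of M - e^2 P can be absorbed on the left. *)
have c0 : 0 < 1 - a / (2 * e).
  rewrite subr_gt0 ltr_pdivrMr ?mulr_gt0 // mul1r.
  by apply: le_lt_trans ae _; rewrite ltr_pMl // ltr1n.
rewrite -(pmulr_rge0 _ c0); apply: le_trans H _.
by rewrite le_eqVlt; apply/orP; left; apply/eqP; ring.
Qed.

(** * Lower bound on the second moment of W^+ *)

Lemma sq_pos_step (R : realFieldType) (l : nat) (e y : R) : 0 < e ->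
  let a := Num.min l%:R e / e in
  e / (e + a) * sq_pos (y + a) <=
  bet_weight R l false * sq_pos (y + 1) + bet_weight R l true * sq_pos (y - l%:R).
Proof.
move=> e0 /=; rewrite /bet_weight /sq_pos.
have l0 : 0 <= l%:R :> R by rewrite ler0n.
have l1 : 0 < l.+1%:R :> R by rewrite ltr0n.
(* If e < l then a = 1: the losing outcome is dropped, and e / (e + 1) <= l / (l + 1) suffices. *)
case: (leP l%:R e) => hle; last first.
  rewrite divff ?gt_eqF // -[X in X <= _]addr0 lerD //; last first.
    by rewrite mulr_ge0 ?sqr_ge0 // invr_ge0 ltW.
  rewrite ler_wpM2r ?sqr_ge0 // ler_pdivrMr ?addr_gt0 // mulrAC.
  by rewrite ler_pdivlMr // -natr1 !mulrDr !mulr1 mulrC lerD2l ltW.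
set x : R := l%:R; have x0 : 0 <= x by [].
have E1 : e / (e + x / e) = e ^+ 2 / (e ^+ 2 + x).
  by field; rewrite !gt_eqF // ?ltr_wpDr // ?exprn_gt0 ?mulr_gt0.
have d0 : 0 < e ^+ 2 + x by rewrite ltr_wpDr ?exprn_gt0.
rewrite E1 -natr1 -/x.
have x1 : 0 < x + 1 by rewrite natr1.
have E2 z : e ^+ 2 / (e ^+ 2 + x) * (z + x / e) ^+ 2 = (e * z + x) ^+ 2 / (e ^+ 2 + x).
  by field; rewrite !gt_eqF.
case: (leP (y + x / e) 0) => h1.
  by rewrite expr0n mulr0 addr_ge0 // mulr_ge0 ?sqr_ge0 ?divr_ge0 ?invr_ge0 // ltW.
have xe1 : x / e <= 1 by rewrite ler_pdivrMr // mul1r.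
have xe0 : 0 <= x / e by rewrite divr_ge0 // ltW.
rewrite max_l; last by apply: ltW; lra.
rewrite E2 ler_pdivrMr //.
have h2 : 0 < e * y + x.
  have : 0 < e * (y + x / e) by rewrite mulr_gt0.
  by rewrite mulrDr mulrCA divff ?gt_eqF // mulr1.
case: (leP (y - x) 0) => h3.
  (* For y <= x the losing outcome contributes nothing, and [r] is the cofactor of e - x in the gap
     between the sides. It is concave in y; the identity below writes it as the linear interpolation
     between y = - x / e and y = x, plus a product vanishing at both ends. *)
  pose r := x * (e + x) + 2 * x * (e - 1) * y - (e + x) * y ^+ 2.
  have r0 : 0 <= r.
    have -> : r = ((x + 1) * (e - x) * e * (e * y + x) +
        (e ^+ 2 + x) * (e - x) * (x - y) +
        (e + x) * (e + 1) * (x - y) * (e * y + x)) / (e * (e + 1)).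
      by rewrite /r; field; rewrite !gt_eqF ?addr_gt0.
    have ex : 0 <= e - x by lra.
    have xy : 0 <= x - y by lra.
    have [e0' h2' x1'] : [/\ 0 <= e, 0 <= e * y + x & 0 <= x + 1].
      by rewrite !ltW.
    by rewrite divr_ge0 // ?addr_ge0 // ?mulr_ge0 // ?addr_ge0 // sqr_ge0.
  rewrite expr0n mulr0 addr0 -subr_ge0.
  have -> : x / (x + 1) * (y + 1) ^+ 2 * (e ^+ 2 + x) - (e * y + x) ^+ 2 =
      (e - x) * r / (x + 1).
    by rewrite /r; field; rewrite gt_eqF.
  by apply: divr_ge0; [apply: mulr_ge0; [rewrite subr_ge0|]|apply: ltW].
rewrite -subr_ge0.
have -> : (x / (x + 1) * (y + 1) ^+ 2 + (x + 1)^-1 * (y - x) ^+ 2) * (e ^+ 2 + x) -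
    (e * y + x) ^+ 2 = x * (y - e) ^+ 2.
  by field; rewrite gt_eqF.
by rewrite mulr_ge0 ?sqr_ge0.
Qed.

Lemma second_moment_ge (R : realFieldType) (n : nat) (l : 'I_n -> nat) (e : R) :
  0 < e -> \sum_(i < n) Num.min (l i)%:R e = e ^+ 2 ->
  e ^+ 2 * (1 - n.+1%:R^-1) ^+ n <=
  expect l (fun b => (n - total_loss l b)%:R ^+ 2).
Proof.
move=> e0 He.
have n0 : (0 < n)%N.
  case: n l He => [l|//]; rewrite big_ord0 => /esym/eqP.
  by rewrite expf_eq0 gt_eqF.
pose a i : R := Num.min (l i)%:R e / e.
have a0 i : 0 <= a i by rewrite divr_ge0 ?le_min ?ler0n //= ltW.
have suma : \sum_i a i = e by rewrite -mulr_suml He expr2 mulfK ?gt_eqF.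
(* Hybrid argument: bets listed in [s] pay the constant a_i instead of their random gain, at the
   price of a factor e / (e + a_i). Thus [h] goes from (W^+)^2 at [[::]] to a constant when all bets
   are listed. *)
pose y (s : seq 'I_n) (b : {ffun 'I_n -> bool}) i :=
  if i \in s then a i else 1 - (b i * (l i).+1)%:R.
pose h s b := \prod_(i <- s) (e / (e + a i)) * sq_pos (\sum_i y s b i).
have h_le s : uniq s -> expect l (h s) <= expect l (h [::]).
  elim: s => [|i s IH] //= /andP[si us]; apply: le_trans (IH us).
  apply: (le_expect_resample (i := i)) => b.
  pose z := \sum_(j < n | j != i) y s b j.
  have hi v : h (i :: s) (update b i v) =
      (\prod_(j <- s) (e / (e + a j))) * (e / (e + a i) * sq_pos (z + a i)).
    rewrite /h big_cons mulrA [_ * (e / (e + a i))]mulrC; congr (_ * sq_pos _).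
    rewrite (bigD1 i) //= addrC /y mem_head; congr (_ + _).
    by apply: eq_bigr => j ji; rewrite inE (negPf ji) updateij.
  have hs v : h s (update b i v) = (\prod_(j <- s) (e / (e + a j))) *
      sq_pos (z + (1 - (v * (l i).+1)%:R)).
    congr (_ * sq_pos _); rewrite (bigD1 i) //= addrC {2}/y (negPf si) updateii.
    by congr (_ + _); apply: eq_bigr => j ji; rewrite /y updateij.
  rewrite !hi !hs -mulrDl bet_weight_sum mul1r.
  set C := \prod_(j <- s) _.
  rewrite [X in _ <= X + _]mulrCA [X in _ <= _ + X]mulrCA -mulrDr ler_wpM2l //.
    by apply: prodr_ge0 => j _; rewrite divr_ge0 ?addr_ge0 // ltW.
  apply: le_trans (sq_pos_step _ _ e0) _; rewrite mul0n mul1n subr0.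
  by have -> : 1 - (l i).+1%:R = - (l i)%:R :> R by rewrite -natr1; ring.
have -> : expect l (fun b => (n - total_loss l b)%:R ^+ 2) = expect l (h [::]).
  apply: eq_bigr => b _; congr (_ * _); rewrite /h big_nil mul1r /sq_pos.
  have -> : \sum_i y [::] b i = n%:R - (total_loss l b)%:R.
    by rewrite /y /= sumrB sumr_const card_ord -natr_sum.
  case: (leqP (total_loss l b) n) => lb.
    by rewrite natrB // max_l // subr_ge0 ler_nat.
  by rewrite (eqP (ltnW lb)) max_r // subr_le0 ler_nat ltnW.
apply: le_trans (h_le _ (index_enum_uniq _)).
have h_all b : h (index_enum 'I_n) b = \prod_i (e / (e + a i)) * e ^+ 2.
  rewrite /h (_ : \sum_i y _ b i = e) /sq_pos ?max_l ?(ltW e0) //.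
  by rewrite -[RHS]suma; apply: eq_bigr => i _; rewrite /y mem_index_enum.
rewrite (_ : expect l _ = expect l (fun=> \prod_i (e / (e + a i)) * e ^+ 2)).
  2: by apply: eq_bigr => b _; rewrite h_all.
rewrite expect_cst.
rewrite mulrC ler_wpM2r ?sqr_ge0 //.
have n0R : 0 < n%:R :> R by rewrite ltr0n.
have c0 i : 0 < 1 + a i / e by rewrite ltr_wpDr // divr_ge0 // ltW.
have -> : \prod_i (e / (e + a i)) = (\prod_i (1 + a i / e))^-1.
  rewrite -prodfV; apply: eq_bigr => i _; field.
  by rewrite !gt_eqF // ltr_wpDr.
have -> : 1 - n.+1%:R^-1 = (1 + n%:R^-1)^-1 :> R.
  by rewrite -natr1; field; rewrite !gt_eqF ?addr_gt0.
rewrite exprVn lef_pV2 ?posrE ?prodr_gt0 ?exprn_gt0 ?addr_gt0 ?invr_gt0 //.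
(* The factors 1 + a_i / e have arithmetic mean 1 + 1/n, because the a_i sum to e. *)
have [AGM _] := @leif_AGM R 'I_n predT (fun i => 1 + a i / e)
  (fun i _ => ltW (c0 i)).
apply: le_trans AGM _; rewrite card_ord big_split /= sumr_const card_ord.
rewrite -mulr_suml suma divff ?gt_eqF // mulrDl divff ?gt_eqF //.
by rewrite mul1r.
Qed.

(** * The balancing e and the bound for independent bets *)

(** Intermediate values on [1, n]: at e = 1 the bet [i0] alone makes the sum at least 1, and at e =
    n each of the n terms is at most n. *)
Lemma exists_balance (R : realType) (n : nat) (l : 'I_n -> nat) (i0 : 'I_n) :
  (0 < l i0)%N ->
  exists2 e : R, 0 < e & \sum_(i < n) Num.min (l i)%:R e = e ^+ 2.
Proof.
move=> l0; have n1 : 1 <= n%:R :> R by rewrite ler1n (leq_trans _ (ltn_ord i0)).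
pose f (e : R) : R := e ^+ 2 - \sum_(i < n) Num.min (l i)%:R e.
have f1 : f 1 <= 0.
  rewrite subr_le0 expr1n (bigD1 i0) //= min_r ?ler1n // lerDl.
  by apply: sumr_ge0 => i _; rewrite le_min ler0n ler01.
have fn : 0 <= f n%:R.
  rewrite subr_ge0 expr2 -[X in _ <= X * _](mulr1n) mulr_natl.
  have -> : (n%:R *+ n : R) = \sum_(i < n) n%:R by rewrite sumr_const card_ord.
  by apply: ler_sum => i _; rewrite ge_min lexx orbT.
have cf : continuous f.
  move=> x; apply: cvgB; first exact: exprn_continuous.
  apply: cvg_big => [|i _]; first exact: add_continuous.
  exact: (@continuous_min R R (fun=> (l i)%:R) id x (cvg_cst _) cvg_id).
have [|e /itvP e1 fe] := IVT n1 (continuous_subspaceT cf) (v := 0).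
  by rewrite ge_min f1 le_max fn orbT.
exists e; first by rewrite (lt_le_trans ltr01) ?e1.
by apply/esym/eqP; rewrite -subr_eq0; apply/eqP.
Qed.

Lemma prob_bets_ge (R : realType) (n : nat) (l : 'I_n -> nat) :
  (1 - n.+1%:R^-1) ^+ n <=
  expect l (fun b => (total_loss l b <= n)%N%:R) :> R.
Proof.
have [/existsP[i0 li0]|] := boolP [exists i, (0 < l i)%N].
  have [e e0 He] := exists_balance R li0.
  have := le_trans (second_moment_ge e0 He) (second_moment_le e0 He).
  by rewrite ler_pM2l ?exprn_gt0.
(* If all l_i are 0, no e > 0 balances, but each loss is at most 1, so the event is certain. *)
rewrite negb_exists => /forallP l0.
rewrite (_ : expect l _ = expect l (fun=> 1)).
  2: {
    apply: eq_bigr => b _; rewrite /total_loss.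
    rewrite (_ : (_ <= n)%N = true) //.
    rewrite -[X in (_ <= X)%N]card_ord -sum1_card leq_sum // => i _.
    by have := l0 i; rewrite lt0n negbK => /eqP ->; case: (b i).
  }
rewrite expect_cst exprn_ile1 ?lerBlDr ?lerDl ?invr_ge0 ?ler0n //.
by rewrite subr_ge0 invf_le1 ?ltr0n // ler1n.
Qed.

(** * Two-point laws and their mixtures *)

(** The index is the loss, so the atoms are 0 and k + 1; k = 0 is the point mass at 1. *)
Definition two_point (R : realFieldType) (k x : nat) : R :=
  \sum_(b : bool) bet_weight R k b * (x == b * k.+1)%N%:R.

Lemma two_point_ge0 (R : realFieldType) (k x : nat) : 0 <= two_point R k x.
Proof. by apply: sumr_ge0 => b _; rewrite mulr_ge0 ?bet_weight_ge0 ?ler0n. Qed.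

(** After summing over outcomes b first, each b in the event is matched by its vector of values
    [x0], whose entries are at most the total loss and hence at most n. *)
Lemma prob_two_point_ge (R : realType) (n : nat) (l : 'I_n -> nat) :
  expect l (fun b => (total_loss l b <= n)%N%:R) <=
  \sum_(x : {ffun 'I_n -> 'I_n.+1} | (\sum_(i < n) (x i : nat) <= n)%N)
     \prod_(i < n) two_point R (l i) (x i).
Proof.
under eq_bigr do rewrite bigA_distr_bigA.
rewrite exchange_big /=; apply: ler_sum => b _.
under eq_bigr do rewrite big_split.
rewrite /= -mulr_sumr ler_wpM2l ?bets_weight_ge0 //.
have [lb|_] := leqP; last first.
  by apply: sumr_ge0 => x _; apply: prodr_ge0 => i _; rewrite ler0n.
pose x0 : {ffun 'I_n -> 'I_n.+1} := [ffun i => inord (b i * (l i).+1)].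
have x0E i : x0 i = (b i * (l i).+1)%N :> nat.
  rewrite ffunE inordK // ltnS; apply: leq_trans lb.
  by rewrite /total_loss (bigD1 i) //= leq_addr.
rewrite (bigD1 x0) /=; last by rewrite (eq_bigr _ (fun i _ => x0E i)).
rewrite big1 => [|i _]; last by rewrite x0E eqxx.
rewrite lerDl; apply: sumr_ge0 => x _; apply: prodr_ge0 => i _.
by rewrite ler0n.
Qed.

(** The product of mixtures expands over the choice [f] of a component for each variable. Domination
    by p is asked only up to n, as the event involves no larger value; this leaves the tail of p
    free to be rearranged. *)
Lemma prob_mixture_ge (R : realType) (n m : nat) (w : 'I_m -> R) (p : nat -> R) :
  (forall k, 0 <= w k) -> \sum_k w k = 1 ->
  (forall x, (x <= n)%N -> \sum_k w k * two_point R k x <= p x) ->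
  (1 - n.+1%:R^-1) ^+ n <= prob_sum_le_n n p.
Proof.
move=> w0 w1 wp.
apply: (@le_trans _ _ (\sum_(x : {ffun 'I_n -> 'I_n.+1} |
  (\sum_(i < n) (x i : nat) <= n)%N) \prod_(i < n) \sum_k w k * two_point R k (x i))).
  under eq_bigr do rewrite bigA_distr_bigA.
  rewrite exchange_big /=.
  under eq_bigr do under eq_bigr do rewrite big_split.
  under eq_bigr do rewrite -mulr_sumr.
  have {1}-> : (1 - n.+1%:R^-1) ^+ n =
      \sum_(f : {ffun 'I_n -> 'I_m}) (\prod_i w (f i)) * (1 - n.+1%:R^-1) ^+ n :> R.
    by rewrite -mulr_suml -(bigA_distr_bigA (fun=> w)) big1 ?mul1r.
  apply: ler_sum => f _; rewrite ler_wpM2l ?prodr_ge0 //.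
  exact: le_trans (prob_bets_ge R (fun i => f i)) (prob_two_point_ge R _).
apply: ler_sum => x _; apply: ler_prod => i _.
rewrite wp ?andbT; last by rewrite -ltnS.
by apply: sumr_ge0 => k _; rewrite mulr_ge0 ?two_point_ge0.
Qed.

Lemma two_point0 (R : realFieldType) (k : nat) :
  two_point R k 0 = 1 - k.+1%:R^-1.
Proof.
rewrite /two_point big_bool /= mulr0 add0r mulr1; apply/eqP.
by rewrite eq_sym subr_eq eq_sym; apply/eqP/bet_weight_sum.
Qed.

Lemma two_pointS (R : realFieldType) (k x : nat) :
  two_point R k x.+1 = k.+1%:R^-1 * (k == x)%:R.
Proof.
by rewrite /two_point big_bool mul1n mul0n /= mulr0 addr0 eqSS eq_sym.
Qed.

(** * Reduction of a law of mean 1 to a finite mixture *)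

Lemma truncated_mean_le (R : realType) (p : nat -> R) (n : nat) :
  is_nat_distr p -> has_mean p 1 -> \sum_(k < n) k%:R * p k <= 1.
Proof.
move=> [p0 _] pm; rewrite -(big_mkord predT (fun k => k%:R * p k)).
rewrite -[X in _ <= X](cvg_lim (@Rhausdorff R) pm).
apply: (nondecreasing_cvgn_le (u_ := series (fun k => k%:R * p k))); last first.
  by apply/cvg_ex; exists 1.
by apply: nondecreasing_series => k _ _; rewrite mulr_ge0 ?ler0n.
Qed.

(** The full expectation of n + 1 - X is n, and the omitted terms, with X > n, are nonpositive. *)
Lemma truncated_gap_ge (R : realType) (p : nat -> R) (n : nat) :
  is_nat_distr p -> has_mean p 1 ->
  n%:R <= \sum_(k < n.+1) (n.+1%:R - k%:R) * p k.
Proof.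
move=> [p0 p1] pm.
have cv : (n.+1%:R * series p m - series (fun k => k%:R * p k) m @[m --> \oo]
    --> n.+1%:R * 1 - (1 : R))%classic.
  by apply: cvgB pm; apply: cvgMl_tmp.
rewrite mulr1 -natr1 addrK in cv.
rewrite -[X in X <= _](cvg_lim (@Rhausdorff R) cv).
apply: limr_le; first by apply/cvg_ex; exists n%:R.
exists n.+1 => // m /= nm.
rewrite natr1 !seriesEnat /= mulr_sumr -sumrB (big_cat_nat (n := n.+1)) //=.
rewrite big_mkord -[X in _ <= X]addr0 lerD //.
  by apply: ler_sum => k _; rewrite mulrBl.
rewrite big_nat; apply: sumr_le0 => k /andP[nk _].
by rewrite -mulrBl mulr_le0_ge0 // subr_le0 ler_nat.
Qed.

Lemma prob_sum_le_n_ge (R : realType) (n : nat) (p : nat -> R) :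
  is_nat_distr p -> has_mean p 1 ->
  (1 - n.+1%:R^-1) ^+ n <= prob_sum_le_n n p.
Proof.
move=> pd pm; have p0 := pd.1.
pose W : R := \sum_(k < n) k.+1%:R * p k.+1.
have W1 : W <= 1.
  have := truncated_mean_le n.+1 pd pm.
  by rewrite big_ord_recl mul0r add0r.
(* Weight (k + 1) p(k + 1) on component k reproduces p at k + 1 <= n. The leftover 1 - W goes to
   component n, whose atom n + 1 lies outside the event. *)
pose w (k : 'I_n.+1) : R := if (k < n)%N then k.+1%:R * p k.+1 else 1 - W.
have wE (F : nat -> R) :
    \sum_k w k * F k = \sum_(k < n) k.+1%:R * p k.+1 * F k + (1 - W) * F n.
  rewrite big_ord_recr /= {2}/w ltnn; congr (_ + _).
  by apply: eq_bigr => k _; rewrite /w /= ltn_ord.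
apply: (prob_mixture_ge (w := w)).
- move=> k; rewrite /w; case: ifP => _; first by rewrite mulr_ge0 ?ler0n.
  by rewrite subr_ge0.
- rewrite -(eq_bigr _ (fun k _ => mulr1 (w k))) (wE (fun=> 1)) mulr1.
  by rewrite (eq_bigr _ (fun k _ => mulr1 _)) -/W addrC subrK.
move=> [|x] xn; last first.
  rewrite (wE (fun k => two_point R k x.+1)) (bigD1 (Ordinal xn)) //= big1; last first.
    move=> k kx; rewrite two_pointS (_ : (k == x :> nat) = false) ?mulr0 //.
    by apply/negbTE.
  rewrite !two_pointS eqxx (_ : (n == x) = false) ?mulr0 ?addr0; last first.
    by apply/eqP => nx; rewrite nx ltnn in xn.
  rewrite mulr1 mulrAC divff ?mul1r //.
  by rewrite pnatr_eq0.
(* At 0 the comparison, multiplied by n + 1, is exactly [truncated_gap_ge]. *)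
rewrite (wE (fun k => two_point R k 0)).
have := truncated_gap_ge n pd pm.
rewrite big_ord_recl subr0 two_point0.
under eq_bigr do rewrite /= mulrBl.
rewrite sumrB -mulr_sumr -/W.
under [X in _ -> X + _ <= _]eq_bigr => k _.
  rewrite two_point0 mulrBr mulr1 [_ / _]mulrAC divff ?mul1r; last by rewrite pnatr_eq0.
  over.
rewrite sumrB -/W; set Q := \sum_(k < n) p k.+1 => H.
have n1 : 0 < n.+1%:R :> R by rewrite ltr0n.
rewrite -(ler_pM2l n1).
have -> : n.+1%:R * (W - Q + (1 - W) * (1 - n.+1%:R^-1)) =
    n.+1%:R - 1 + W - n.+1%:R * Q.
  by field; rewrite addrC natr1 gt_eqF.
by move: H; rewrite -natr1; lra.
Qed.

(** * The extremal law *)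

(** The factor [c] covers total mass (c = 1) and mean (c k = k) at once; the partial sums are
    constant from index n + 2 on. *)
Lemma extremal_cvg (R : realType) (n : nat) (c : nat -> R) :
  (series (fun k => c k * extremal_distr R n k) @ \oo -->
   c 0%N * (1 - n.+1%:R^-1) + c n.+1 * n.+1%:R^-1)%classic.
Proof.
apply: cvg_near_cst; exists n.+2 => // m /= nm.
rewrite seriesEnat /= (big_cat_nat (n := n.+2)) //= [X in _ + X]big_nat.
rewrite [X in _ + X]big1 ?addr0 => [|k /andP[nk _]].
  rewrite big_nat_recl // big_nat_recr //= big_nat big1 ?add0r => [|k kn].
    by rewrite /extremal_distr /= eqxx.
  by rewrite /extremal_distr eqSS /= ltn_eqF ?mulr0.
by rewrite /extremal_distr !gtn_eqF ?mulr0 // (leq_trans _ nk).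
Qed.

(** A nonzero entry of x lies between 1 and n, where the law has no mass, so only the zero vector
    contributes. *)
Lemma extremal_prob (R : realType) (n : nat) :
  prob_sum_le_n n (extremal_distr R n) = (1 - n.+1%:R^-1) ^+ n.
Proof.
rewrite /prob_sum_le_n (bigD1 [ffun=> ord0]) /=; last first.
  by rewrite big1 // => i _; rewrite ffunE.
rewrite [X in _ + X]big1 ?addr0.
  under eq_bigr do rewrite ffunE.
  by rewrite prodr_const card_ord.
move=> x /andP[_ x0].
have /existsP[i xi] : [exists i, x i != ord0].
  apply: contraR x0; rewrite negb_exists => /forallP x0; apply/eqP/ffunP => i.
  by apply/eqP; have := x0 i; rewrite negbK ffunE.
rewrite (bigD1 i) //= /extremal_distr (negbTE (_ : x i != 0%N :> nat)) //.
by rewrite ltn_eqF ?mul0r.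
Qed.

Unset Implicit Arguments.
Set Strict Implicit.

Theorem mainTheorem5 (R : realType) (n : nat) (hn : (2 <= n)%N) :
  (forall p : nat -> R, is_nat_distr p -> has_mean p 1 ->
     (1 - (n.+1%:R)^-1) ^+ n <= prob_sum_le_n n p)
  /\ (is_nat_distr (extremal_distr R n) /\ has_mean (extremal_distr R n) 1 /\
      prob_sum_le_n n (extremal_distr R n) = (1 - (n.+1%:R)^-1) ^+ n).
Proof.
split; first by move=> p; apply: prob_sum_le_n_ge.
have inv : n.+1%:R * n.+1%:R^-1 = 1 :> R by rewrite divff // pnatr_eq0.
split; [split|split; last exact: extremal_prob].
- move=> k; rewrite /extremal_distr; case: ifP => _.
    by rewrite subr_ge0 invf_le1 ?ltr0n // ler1n.
  by case: ifP => _; rewrite // invr_ge0 ler0n.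
- have := @extremal_cvg R n (fun=> 1); rewrite !mul1r subrK.
  rewrite (_ : (fun k => _) = extremal_distr R n) //.
  by apply/funext => k; rewrite mul1r.
- have := @extremal_cvg R n (fun k => k%:R).
  by rewrite mul0r add0r inv.
Qed.
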